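(* Let $G$ be a group with trivial element $e$, and let $\Lambda$ be a finite dimensional complex algebra with a $G$-grading $\Lambda=\bigoplus_{g\in G}\Lambda_g$ with respect to which $\Lambda$ is $G$-simple. Then $\dim_{\mathbb{C}}(\Lambda_e)\geq \dim_{\mathbb{C}}(\Lambda_g)$ for any $g\in G$.
   Context: Algebras are associative with unit. A grading of an algebra $\Lambda$ by a group $G$ is a vector space decomposition $\Lambda=\bigoplus_{g\in G}\Lambda_g$ such that $\Lambda_g\Lambda_h\subseteq\Lambda_{gh}$ for all $g,h\in G$. A (two-sided) ideal $I$ of $\Lambda$ is graded if $I=\bigoplus_{g\in G}(I\cap\Lambda_g)$. The algebra $\Lambda$ is $G$-simple with respect to the grading if it admits no non-trivial graded ideals, i.e. its only graded two-sided ideals are $0$ and $\Lambda$. *)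

(* Defs.v *)
From HB Require Import structures.
From mathcomp Require Export all_boot all_order all_algebra all_field.
From mathcomp Require Export reals complex.

Set Implicit Arguments.
Unset Strict Implicit.
Unset Printing Implicit Defensive.

Local Open Scope ring_scope.

(* W is the internal direct sum of the family U. The index type may be infinite,
   so sums range over duplicate-free finite sequences of indices. *)
Definition is_direct_sum (K : fieldType) (V : vectType K) (J : eqType)
    (W : {vspace V}) (U : J -> {vspace V}) : Prop :=
  [/\ forall j : J, (U j <= W)%VS,
      forall w : V, w \in W ->
        exists2 s : seq J, uniq s & w \in (\sum_(j <- s) U j)%VS
    & forall s : seq J, uniq s -> directv (\sum_(j <- s) U j)].

Definition is_grading (K : fieldType) (A : falgType K) (G : groupType)
    (L : G -> {vspace A}) : Prop :=
  is_direct_sum fullv L /\ forall g h : G, (L g * L h <= L (g * h)%g)%VS.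

(* As A is unital, its two-sided ideals are automatically linear subspaces. *)
Definition is_ideal (K : fieldType) (A : falgType K) (I : {vspace A}) : Prop :=
  (fullv * I <= I)%VS /\ (I * fullv <= I)%VS.

Definition is_graded_ideal (K : fieldType) (A : falgType K) (G : groupType)
    (L : G -> {vspace A}) (I : {vspace A}) : Prop :=
  is_ideal I /\ is_direct_sum I (fun g : G => (I :&: L g)%VS).

Definition graded_simple (K : fieldType) (A : falgType K) (G : groupType)
    (L : G -> {vspace A}) : Prop :=
  forall I : {vspace A}, is_graded_ideal L I -> I = 0%VS \/ I = fullv.

(* Main.v *)
(** Let [w] be a nonzero homogeneous element with [A w] of minimal dimension.
    Then [V = A w] is a graded-simple module, and it is faithful because its
    annihilator is a proper graded ideal.  Each nonzero component [V_x] is a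
    simple module over [L 1], and by Schur and Jacobson density
    [sum_(t in T) n_t ^ 2 <= dim (L 1)], where [n_t = dim V_t], as soon as the
    components [V_t], [t] in [T], have distinct annihilators in [L 1].  If
    moreover [T] represents all these annihilators, an element of [L g] is
    determined by its restrictions [V_t -> V_(gt)], so
    [dim (L g) <= sum_(t in T) n_t n_(gt)].  The components [V_(gt)] again have
    distinct annihilators, so [2 n_t n_(gt) <= n_t ^ 2 + n_(gt) ^ 2] concludes. *)

Require Import Defs.
From mathcomp Require Import all_boot all_order all_algebra all_field.
From mathcomp Require Import boolp reals complex.

Set Implicit Arguments.
Unset Strict Implicit.
Unset Printing Implicit Defensive.

Import GRing.Theory.

Local Open Scope ring_scope.

(** * Preliminaries on direct sums, transversals and eigenvectors *)

Lemma directv_sumS (K : fieldType) (V : vectType K) (J : Type) (r : seq J)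
    (U W : J -> {vspace V}) :
    (forall j, (U j <= W j)%VS) ->
  directv (\sum_(j <- r) W j) -> directv (\sum_(j <- r) U j).
Proof.
move=> sUW; rewrite !directvE /= !(big_tnth _ _ r) -!directvE /=.
move=> /directv_sum_independent dxW; apply/directv_sum_independent => us Uus.
by apply: dxW => i _; apply/(subvP (sUW _))/Uus.
Qed.

Lemma subv_sum_seq (K : fieldType) (V : vectType K) (J : eqType) (q r : seq J)
    (U : J -> {vspace V}) :
  {subset q <= r} -> (\sum_(j <- q) U j <= \sum_(j <- r) U j)%VS.
Proof.
move=> sqr; rewrite big_tnth; apply/subv_sumP => i _.
by rewrite (big_rem (tnth (in_tuple q) i)) ?addvSl //= sqr ?mem_tnth.
Qed.

Lemma directv_sum_seq_independent (K : fieldType) (V : vectType K) (J : eqType)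
    (r : seq J) (U : J -> {vspace V}) (u : J -> V) :
    directv (\sum_(j <- r) U j) -> (forall j, u j \in U j) ->
  \sum_(j <- r) u j = 0 -> {in r, forall j, u j = 0}.
Proof.
rewrite directvE /= !(big_tnth _ _ r) -directvE /=.
move=> /directv_sum_independent dxU Uu u0 j /(tnthP (in_tuple r))[i ->].
exact: (dxU (fun i => u (tnth (in_tuple r) i))).
Qed.

Lemma exists_transversal (X Y : eqType) (f : X -> Y) (r : seq X) :
  exists t : seq X, [/\ uniq t, {in t &, injective f} &
    {in r, forall x, exists2 y, y \in t & f y = f x}].
Proof.
elim: r => [|x r [t [ut injf tP]]]; first by exists [::].
have [/mapP[y ty fxy]|nfx] := boolP (f x \in map f t).
  by exists t; split=> // z /predU1P[-> | /tP//]; exists y.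
exists (x :: t); split; rewrite /= ?ut ?andbT.
- by apply: contra nfx; apply: map_f.
- move=> y z /predU1P[->|yt] /predU1P[->|zt] // E; last exact: injf.
    by case/mapP: nfx; exists z.
  by case/mapP: nfx; exists y.
move=> z /predU1P[-> | /tP[y ty fy]]; first by exists x; rewrite ?mem_head.
by exists y; rewrite // in_cons ty orbT.
Qed.

(** Choosing a preimage [a i] under [f] for each basis vector of [f @: B] and sending that basis
    vector to [g (a i)] gives an endomorphism of [f @: B], which has an eigenvector since [K] is
    algebraically closed. *)
Lemma pencil_eigenvector (K : closedFieldType) (aT rT : vectType K)
    (f g : 'Hom(aT, rT)) (B : {vspace aT}) :
    (f @: B != 0)%VS -> (g @: B <= f @: B)%VS ->
  exists2 a, a \in B & exists2 k, f a != 0 & g a = k *: f a.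
Proof.
set W := (f @: B)%VS => W0 sgW; set n := \dim W.
have n_gt0 : (0 < n)%N by rewrite lt0n dimv_eq0.
pose e := vbasis W.
have /fin_all_exists2[a aB fa] : forall i : 'I_n, exists2 b, b \in B & e`_i = f b.
  by move=> i; apply/memv_imgP/vbasis_mem/mem_nth; rewrite size_tuple.
pose M := \matrix_(i < n, j < n) coord e j (g (a i)).
have [k /eigenvalueP[u uM u0]] : exists k, eigenvalue M k.
  have /closed_rootP[k rk] : size (char_poly M) != 1%N.
    by rewrite size_char_poly; case: (n) n_gt0.
  by exists k; rewrite eigenvalue_root_char.
exists (\sum_i u 0 i *: a i); first by apply: memv_suml => i _; apply/memvZ/aB.
have fE : f (\sum_i u 0 i *: a i) = \sum_i u 0 i *: e`_i.
  by rewrite linear_sum; apply: eq_bigr => i _; rewrite linearZ /= fa.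
exists k.
  rewrite fE; apply: contra u0 => /eqP ui0.
  have /freeP fe := basis_free (vbasisP W).
  by apply/eqP/rowP => i; rewrite mxE (fe _ ui0).
rewrite fE linear_sum scaler_sumr /=.
transitivity (\sum_i \sum_j (u 0 i * M i j) *: e`_j).
  apply: eq_bigr => i _; rewrite linearZ /=.
  rewrite {1}(coord_vbasis (subvP sgW _ (memv_img g (aB i)))) scaler_sumr.
  by apply: eq_bigr => j _; rewrite scalerA mxE.
rewrite exchange_big /=; apply: eq_bigr => j _.
by rewrite -scaler_suml scalerA; move/rowP/(_ j): uM; rewrite !mxE => ->.
Qed.

(** * Left annihilators as subspaces *)

Section Annihilator.

Variables (K : fieldType) (A : falgType K).
Implicit Types (E U : {vspace A}) (a u v : A) (vs : seq A).

Definition annv E vs := (E :&: \bigcap_(v <- vs) lker (amulr v))%VS.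

Lemma annvP E vs a :
  reflect (a \in E /\ {in vs, forall v, a * v = 0}) (a \in annv E vs).
Proof.
rewrite memv_cap; apply: (iffP andP) => -[aE H]; split=> //.
  elim: vs H => [|v vs IHvs]; rewrite ?big_cons // memv_cap memv_ker lfunE /=.
  by case/andP=> /eqP av0 /IHvs avs0 u /predU1P[->|/avs0].
elim: vs H => [|v vs IHvs] H; rewrite ?big_nil ?memvf // big_cons memv_cap.
rewrite memv_ker lfunE /= H ?mem_head // eqxx IHvs // => u uvs.
by rewrite H // in_cons uvs orbT.
Qed.

Lemma annv_vbasisP E U a :
  reflect (a \in E /\ {in U, forall v, a * v = 0}) (a \in annv E (vbasis U)).
Proof.
apply: (iffP (annvP _ _ _)) => -[aE aU]; split=> // v Uv; last exact/aU/vbasis_mem.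
rewrite (coord_vbasis Uv) mulr_sumr big1 // => i _.
by rewrite -scalerAr aU ?scaler0 // mem_nth // size_tuple.
Qed.

(** Rank-nullity for right multiplication by [v] on [annv E vs]. *)
Lemma dim_annv_cons E v vs :
  (\dim (annv E (v :: vs)) + \dim (annv E vs * <[v]>) = \dim (annv E vs))%N.
Proof.
rewrite -limg_amulr -(limg_ker_dim (amulr v) (annv E vs)) /annv big_cons.
by rewrite -capvA [(_ :&: lker _)%VS]capvC.
Qed.

End Annihilator.

(* [M x] is the component of a graded-simple, faithful module in degree [x]. *)
Section GradedSimpleModule.

Variables (K : closedFieldType) (A : falgType K) (G : groupType).
Variables L M : G -> {vspace A}.

Hypothesis LL_sub : forall g h a b, a \in L g -> b \in L h -> a * b \in L (g * h)%g.
Hypothesis LM_sub : forall g x a u, a \in L g -> u \in M x -> a * u \in M (g * x)%g.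
Hypothesis M_simple : forall x z u u', u \in M x -> u != 0 -> u' \in M z ->
  exists2 b, b \in L (z / x)%g & u' = b * u.
Hypothesis M_direct : forall T : seq G, uniq T -> directv (\sum_(x <- T) M x).
Hypothesis M_faithful : forall g f, f \in L g ->
  (forall x, {in M x, forall u, f * u = 0}) -> f = 0.

Lemma M_simple1 x u u' : u \in M x -> u != 0 -> u' \in M x ->
  exists2 b, b \in L 1%g & u' = b * u.
Proof. by move=> uM u0 u'M; rewrite -(mulgV x); apply: (M_simple uM). Qed.

Lemma L1M x a u : a \in L 1%g -> u \in M x -> a * u \in M x.
Proof. by move=> a1 uM; rewrite -(mul1g x) LM_sub. Qed.

Lemma annv_L1_mul vs a b : b \in L 1%g -> a \in annv (L 1%g) vs ->
  b * a \in annv (L 1%g) vs.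
Proof.
move=> b1 /annvP[a1 a0]; apply/annvP; split; first by rewrite -(mulg1 1%g) LL_sub.
by move=> u uvs; rewrite -mulrA a0 ?mulr0.
Qed.

(** The left side is an [L 1]-submodule of the simple module [M x], nonzero because it contains
    [a * u]. *)
Lemma annv_mul_eq vs x a u : u \in M x -> a \in annv (L 1%g) vs -> a * u != 0 ->
  (annv (L 1%g) vs * <[u]>)%VS = M x.
Proof.
move=> uM av au0; have [a1 _] := annvP _ _ _ av.
apply/eqP; rewrite eqEsubv -limg_amulr; apply/andP; split; apply/subvP => w.
  by case/memv_imgP=> b /annvP[b1 _] ->; rewrite lfunE /= L1M.
case/(M_simple1 (L1M a1 uM) au0) => b b1 ->; apply/memv_imgP.
by exists (b * a); rewrite ?annv_L1_mul // lfunE /= mulrA.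
Qed.

(** For nonzero [M x], this stands in for the isomorphism class of the simple [L 1]-module [M x]. *)
Definition ann1 x := annv (L 1%g) (vbasis (M x)).

(** Jacobson density as a double annihilator property. In the induction step, either [B] kills [v]
    already, or [a * w |-> a * v] is an isomorphism from [M z] to [M x]. *)
Lemma density (T : seq G) (vs : seq A) x v :
    {in T &, injective ann1} ->
    {in vs, forall u, exists2 t, t \in T & u \in M t} ->
    x \in T -> v \in M x -> {in annv (L 1%g) vs, forall a, a * v = 0} ->
  v \in <<vs>>%VS.
Proof.
move=> injT; elim: vs x v => [|w vs IHvs] x v vsM xT vM av0.
  have [->|v0] := eqVneq v 0; first exact: mem0v.
  have [b b1 bv] := M_simple1 vM v0 vM.
  by move: v0; rewrite {1}bv av0 ?eqxx //; apply/annvP.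
have {}IHvs y u := IHvs y u (sub_in1 (@mem_behead _ (w :: vs)) vsM).
have [z zT wM] := vsM w (mem_head _ _).
set B := annv (L 1%g) vs in IHvs.
have avw a : a \in B -> a * w = 0 -> a * v = 0.
  move=> /annvP[a1 avs] aw; apply: av0; apply/annvP; split=> // u.
  by case/predU1P=> [->|/avs].
have sub_vs : (<<vs>> <= <<w :: vs>>)%VS by rewrite span_cons addvSr.
have [sBv|] := boolP (B <= lker (amulr v))%VS.
  apply: (subvP sub_vs); apply: (IHvs x) => // a /(subvP sBv).
  by rewrite memv_ker lfunE => /eqP.
case/subvPn=> a1 a1B; rewrite memv_ker lfunE /= => a1v.
have a1w : a1 * w != 0 by apply: contraNneq a1v => /(avw _ a1B)->.
have a1L : a1 \in L 1%g by case/annvP: a1B.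
have Bw := annv_mul_eq wM a1B a1w; have Bv := annv_mul_eq vM a1B a1v.
(* Converse of [avw]: if [a * w] were nonzero, then [a1 * w = b * a * w] for some [b], so
   [a1 - b * a] would kill [w], hence [v], forcing [a1 * v = 0]. *)
have w_of_v a : a \in B -> a * v = 0 -> a * w = 0.
  move=> aB av; apply: contraNeq a1v => aw.
  have aL : a \in L 1%g by case/annvP: aB.
  have [b b1 E] := M_simple1 (L1M aL wM) aw (L1M a1L wM).
  rewrite -(subrK (b * a * v) (a1 * v)) -mulrBl avw -?mulrA ?av ?mulr0 ?addr0 //.
    by rewrite rpredB // annv_L1_mul.
  by rewrite mulrBl -mulrA -E subrr.
(* By [avw] and [w_of_v], an element of [L 1] kills [B w = M z] exactly when it kills
   [B v = M x]. *)
have eq_zx : z = x.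
  apply: injT => //; apply/vspaceP => c.
  suff E : {in B, forall a, c \in L 1%g -> (c * (a * w) == 0) = (c * (a * v) == 0)}.
    apply/annv_vbasisP/annv_vbasisP => -[c1 cM]; split=> // u.
      rewrite -Bv -limg_amulr => /memv_imgP[a aB ->]; rewrite lfunE /=.
      by apply/eqP; rewrite -E //; apply/eqP/cM/L1M => //; case/annvP: aB.
    rewrite -Bw -limg_amulr => /memv_imgP[a aB ->]; rewrite lfunE /=.
    by apply/eqP; rewrite E //; apply/eqP/cM/L1M => //; case/annvP: aB.
  move=> a aB c1; rewrite !mulrA.
  by apply/eqP/eqP; [apply: avw | apply: w_of_v]; apply: annv_L1_mul.
(* Schur: [a * w |-> a * v], for [a] in [B], is a well-defined [L 1]-linear
   endomorphism of the simple module [M x], hence a scalar [k]. *)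
case: (@pencil_eigenvector _ _ _ (amulr w) (amulr v) B).
- by rewrite limg_amulr Bw; apply: contraNneq a1w => M0; rewrite -memv0 -M0 L1M.
- by rewrite !limg_amulr Bw Bv eq_zx.
move=> a aB [k]; rewrite !lfunE /= => aw akv.
have aL : a \in L 1%g by case/annvP: aB.
(* For [c] in [B], writing [c * w = b * a * w] gives [c * v = b * a * v = k *: (c * w)], so the
   induction hypothesis applies. *)
have: v - k *: w \in <<vs>>%VS.
  apply: (IHvs x) => //; first by rewrite rpredB // rpredZ // -eq_zx.
  move=> c cB; have cL : c \in L 1%g by case/annvP: cB.
  have [b b1 E] := M_simple1 (L1M aL wM) aw (L1M cL wM).
  have: (b * a - c) * v = 0.
    apply: avw; first by rewrite rpredB // annv_L1_mul.
    by rewrite mulrBl -mulrA -E subrr.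
  rewrite mulrBl -mulrA akv mulrBr -!scalerAr -E => /eqP.
  by rewrite subr_eq0 => /eqP->; rewrite subrr.
move/(subvP sub_vs) => kv; rewrite -(subrK (k *: w) v) rpredD // rpredZ //.
by rewrite memv_span ?mem_head.
Qed.

(** By density, a vector [v] of [M x] independent of the others is not killed by their annihilator,
    which thus maps onto all of [M x]; adding [v] lowers its dimension by exactly [\dim (M x)]. *)
Lemma annv_L1_count (T : seq G) (ps : seq (G * A)) :
    {in T &, injective ann1} ->
    {in ps, forall p, p.1 \in T /\ p.2 \in M p.1} -> free (unzip2 ps) ->
  (\dim (annv (L 1%g) (unzip2 ps)) + \sum_(p <- ps) \dim (M p.1) <= \dim (L 1%g))%N.
Proof.
move=> injT; elim: ps => [|[x v] ps IHps] psM /=.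
  by rewrite big_nil addn0 dimvS // capvSl.
rewrite free_cons big_cons => /andP[nv fps].
have {}IHps : (\dim (annv (L 1%g) (unzip2 ps)) + \sum_(p <- ps) \dim (M p.1)
    <= \dim (L 1%g))%N.
  by apply: IHps => // p pps; apply/psM/(@mem_behead _ (_ :: _)).
have [/= xT vM] := psM _ (mem_head _ _).
have /subvPn[a aB av] : ~~ (annv (L 1%g) (unzip2 ps) <= lker (amulr v))%VS.
  apply: contra nv => /subvP sBv; apply: (density injT _ xT vM).
    move=> u /mapP[p /(@mem_behead _ ((x, v) :: ps))/psM[pT pM] ->].
    by exists p.1.
  by move=> a /sBv; rewrite memv_ker lfunE => /eqP.
rewrite memv_ker lfunE /= in av.
by rewrite /= addnA -(annv_mul_eq vM aB av) dim_annv_cons.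
Qed.

(** Here each vector of [M x] lowers the dimension by at most [\dim (M (g * x))], since [L g] maps
    it into that component. *)
Lemma annv_Lg_count g (ps : seq (G * A)) :
    {in ps, forall p, p.2 \in M p.1} ->
  (\dim (L g) <=
     \dim (annv (L g) (unzip2 ps)) + \sum_(p <- ps) \dim (M (g * p.1)%g))%N.
Proof.
elim: ps => [|[x v] ps IHps] psM /=.
  by rewrite big_nil addn0 /annv big_nil capvf.
have vM := psM _ (mem_head _ _); rewrite /= in vM.
rewrite big_cons addnA; apply: leq_trans (IHps _) _.
  by move=> p pps; apply/psM/(@mem_behead _ (_ :: _)).
rewrite leq_add2r -(dim_annv_cons _ v) leq_add2l dimvS // -limg_amulr.
apply/subvP => _ /memv_imgP[a /annvP[ag _] ->]; rewrite lfunE.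
exact: LM_sub.
Qed.

Definition homog_basis (T : seq G) := [seq (t, v) | t <- T, v <- vbasis (M t)].

Lemma homog_basisP T p : p \in homog_basis T -> p.1 \in T /\ p.2 \in M p.1.
Proof. by case/allpairsPdep=> t [v [tT /vbasis_mem vM ->]]. Qed.

Lemma sum_homog_basis T (F : G -> nat) :
  (\sum_(p <- homog_basis T) F p.1 = \sum_(t <- T) \dim (M t) * F t)%N.
Proof.
rewrite /homog_basis big_allpairs_dep; apply: eq_bigr => t _ /=.
by rewrite big_tnth sum_nat_const card_ord size_tuple.
Qed.

Lemma homog_basis_free T : uniq T -> free (unzip2 (homog_basis T)).
Proof.
move=> uT; have := M_direct uT; suff [E sz] : <<unzip2 (homog_basis T)>>%VS =
    (\sum_(t <- T) M t)%VS /\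
    size (unzip2 (homog_basis T)) = (\sum_(t <- T) \dim (M t))%N.
  by rewrite directvE /= /free E sz.
elim: T {uT} => [|t T [IH1 IH2]]; first by rewrite !big_nil span_nil.
rewrite /homog_basis /= /unzip2 map_cat span_cat size_cat !big_cons.
rewrite -/(homog_basis T) -/(unzip2 (homog_basis T)) IH1 IH2 -map_comp map_id.
by rewrite (span_basis (vbasisP _)) size_tuple.
Qed.

Lemma sum_sqr_dim_le (T : seq G) : uniq T -> {in T &, injective ann1} ->
  (\sum_(t <- T) \dim (M t) ^ 2 <= \dim (L 1%g))%N.
Proof.
move=> uT injT.
have := annv_L1_count injT (@homog_basisP T) (homog_basis_free uT).
by apply: leq_trans; rewrite (sum_homog_basis T (fun t => \dim (M t))) leq_addl.
Qed.

(** If [f * u] were nonzero, any [v] in [M y] would be [b * f * u] with [b * f] in [ann1 x], hence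
    in [ann1 y], so [M y] would vanish. *)
Lemma mul_eq0_transfer g x y f :
    (ann1 x <= ann1 y)%VS -> M y != 0%VS -> f \in L g ->
    {in M x, forall u, f * u = 0} ->
  {in M y, forall u, f * u = 0}.
Proof.
move=> sxy My fg fx u uy; apply: contraNeq My => fu.
rewrite -subv0; apply/subvP => v vy.
have [b bg ->] := M_simple (LM_sub fg uy) fu vy.
suff /(subvP sxy)/annv_vbasisP[_ bf0] : b * f \in ann1 x.
  by rewrite mulrA bf0 ?mem0v.
apply/annv_vbasisP; split; last by move=> w /fx fw; rewrite -mulrA fw mulr0.
by have := LL_sub bg fg; rewrite invgM mulgA mulgV mul1g mulVg.
Qed.

(** Any [u] in [M y] is [b * v] with [v] in [M (g * y)] and [b] of degree [g^-1]. If [a] kills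
    [M x], then [a * b] kills [M (g * x)], hence also [M (g * y)]. *)
Lemma ann1_shift g x y : M (g * x)%g != 0%VS -> M (g * y)%g != 0%VS ->
  ann1 (g * x)%g = ann1 (g * y)%g -> (ann1 x <= ann1 y)%VS.
Proof.
move=> Mgx Mgy E; apply/subvP => a /annv_vbasisP[a1 ax].
apply/annv_vbasisP; split=> // u uy.
have v0 : vpick (M (g * y)%g) != 0 by rewrite vpick0.
have [b bg ->] := M_simple (memv_pick _) v0 uy.
rewrite mulrA; apply: (@mul_eq0_transfer _ (g * x)%g _ _ _ _ (LL_sub a1 bg) _ _ (memv_pick _)) => //.
  by rewrite E subvv.
move=> w wgx; rewrite -mulrA ax //; have := LM_sub bg wgx.
by rewrite invgM !mulgA mulgV mul1g mulVg mul1g.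
Qed.

Lemma dim_homogeneous_le (S : seq G) g :
  (forall x, M x != 0%VS -> x \in S) -> (\dim (L g) <= \dim (L 1%g))%N.
Proof.
move=> supp; pose S0 := [seq x <- S | M x != 0%VS].
have [T [uT injT TP]] := exists_transversal ann1 S0.
(* Zero components all have annihilator [L 1], so keeping them could break injectivity; their
   squared dimensions contribute nothing anyway. *)
pose gT := [seq (g * t)%g | t <- T & M (g * t)%g != 0%VS].
have ugT : uniq gT by rewrite map_inj_uniq ?filter_uniq //; apply: mulgI.
have injgT : {in gT &, injective ann1}.
  move=> gx gy /mapP[x + ->] /mapP[y + ->].
  rewrite !mem_filter => /andP[Mx xT] /andP[My yT] E.
  congr (g * _)%g; apply: injT => //; apply/eqP; rewrite eqEsubv.
  by rewrite (ann1_shift Mx My E) (ann1_shift My Mx (esym E)).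
have sum_gT : (\sum_(t <- T) \dim (M (g * t)%g) ^ 2 <= \dim (L 1%g))%N.
  apply: leq_trans (sum_sqr_dim_le ugT injgT).
  rewrite big_map big_filter [leqRHS]big_mkcond; apply: leq_sum => t _.
  by case: eqP => // ->; rewrite dimv0.
have annT0 : annv (L g) (unzip2 (homog_basis T)) = 0%VS.
  apply/eqP; rewrite -subv0; apply/subvP => f /annvP[fg fT].
  rewrite memv0; apply/eqP/(M_faithful fg) => x.
  have [M0|Mx] := eqVneq (M x) 0%VS.
    by rewrite M0 => u; rewrite memv0 => /eqP->; rewrite mulr0.
  have [t tT E] : exists2 t, t \in T & ann1 t = ann1 x.
    by apply: TP; rewrite mem_filter Mx supp.
  apply: (@mul_eq0_transfer g t x) => //; first by rewrite E subvv.
  suff /annv_vbasisP[] : f \in annv (L g) (vbasis (M t)) by [].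
  apply/annvP; split=> // v vt; apply: fT; apply/mapP; exists (t, v) => //.
  by apply/allpairsPdep; exists t, v.
have := @annv_Lg_count g (homog_basis T) (fun p pT => (homog_basisP pT).2).
rewrite annT0 dimv0 (sum_homog_basis T (fun t => \dim (M (g * t)%g))) => dg.
rewrite -(leq_pmul2l (ltn0Sn 1)) [leqRHS]mul2n -addnn.
apply: leq_trans (leq_add (sum_sqr_dim_le uT injT) sum_gT).
rewrite -big_split; apply: leq_trans (leq_mul (leqnn 2) dg) _.
by rewrite big_distrr; apply: leq_sum => t _; rewrite nat_Cauchy.
Qed.

End GradedSimpleModule.

(** * Homogeneous components in a graded algebra *)

Section Grading.

Variables (K : fieldType) (A : falgType K) (G : groupType) (L : G -> {vspace A}).
Hypothesis L_grading : is_grading L.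

Lemma grading_mul g h a b : a \in L g -> b \in L h -> a * b \in L (g * h)%g.
Proof. by move=> ag bh; apply: (subvP (L_grading.2 g h)); apply: memv_mul. Qed.

Lemma grading_shift_independent (r : seq G) (x : G) (u : G -> A) :
    uniq r -> (forall h, u h \in L (h * x)%g) ->
  \sum_(h <- r) u h = 0 -> {in r, forall h, u h = 0}.
Proof.
move=> ur uL; apply: directv_sum_seq_independent uL.
have [[_ _ L_direct] _] := L_grading.
have := L_direct [seq (h * x)%g | h <- r].
rewrite (map_inj_uniq (@mulIg _ x)) => /(_ ur).
by rewrite !directvE /= !big_map.
Qed.

Lemma homogeneous_decomposition (a : A) (g : G) : exists r, exists u : G -> A,
  [/\ uniq r, g \in r, forall h, u h \in L h & a = \sum_(h <- r) u h].
Proof.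
have [[_ /(_ a (memvf a))[r0 ur0 ar0] _] _] := L_grading.
(* Including [g] lets callers extract the component of a prescribed degree. *)
pose r := undup (g :: r0).
have ar : a \in (\sum_(h <- r) L h)%VS.
  apply: subvP ar0; apply: subv_sum_seq => h.
  by rewrite mem_undup in_cons orbC => ->.
exists r, (fun h => sumv_pi_for (erefl (\sum_(h <- r) L h)%VS) h a).
split; rewrite ?undup_uniq ?mem_undup ?mem_head //.
  by move=> h; apply: memv_sum_pi.
by rewrite sumv_pi_uniq_sum // filter_predT undup_uniq.
Qed.

(** Comparing components of degree [z] in [a * v] shows that the component of [a] of degree [z / x]
    serves as [b]. *)
Lemma homogeneous_factor a v x z : v \in L x -> a * v \in L z ->
  exists2 b, b \in L (z / x)%g & a * v = b * v.
Proof.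
move=> vx avz; have [r [u [ur zr uL aE]]] := homogeneous_decomposition a (z / x)%g.
exists (u (z / x)%g) => //.
pose d h := u h * v - (if h == (z / x)%g then a * v else 0).
suff /(_ _ zr)/eqP : {in r, forall h, d h = 0}.
  by rewrite /d eqxx subr_eq0 => /eqP.
apply: (@grading_shift_independent _ x) => // [h|].
  rewrite rpredB ?grading_mul //; case: eqP => [->|_]; rewrite ?mem0v //.
  by rewrite mulgVK.
rewrite sumrB -mulr_suml -aE (bigD1_seq (z / x)%g) //= eqxx.
by rewrite big1 ?addr0 ?subrr // => h /negPf->.
Qed.

Lemma grading_support : exists S : seq G, forall g, L g != 0%VS -> g \in S.
Proof.
have [[_ L_span L_direct] _] := L_grading.
have [S uS fS] : exists2 S, uniq S & (fullv <= \sum_(h <- S) L h)%VS.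
  suff span_seq (vs : seq A) : exists2 S, uniq S &
      {in vs, forall v, v \in \sum_(h <- S) L h}%VS.
    have [S uS bS] := span_seq (vbasis fullv).
    by exists S => //; rewrite -(span_basis (vbasisP fullv)); apply/span_subvP.
  elim: vs => [|v vs [S uS vsS]]; first by exists [::].
  have [r ur vr] := L_span v (memvf v).
  exists (undup (r ++ S)) => [|w]; first exact: undup_uniq.
  case/predU1P=> [->|/vsS].
    by apply: subvP vr; apply: subv_sum_seq => h; rewrite mem_undup mem_cat => ->.
  by apply: subvP; apply: subv_sum_seq => h; rewrite mem_undup mem_cat orbC => ->.
(* For [g] outside [S], directness over [g :: S] makes [L g] meet the sum over [S], which is
   everything, trivially. *)
exists S => g; apply: contraNT => gS; rewrite -subv0.
have := L_direct (g :: S); rewrite /= gS uS => /(_ isT).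
rewrite directvE /= !big_cons -directvE /= directv_addE => /and3P[_ _ /eqP <-].
by rewrite subv_cap subvv (subv_trans (subvf _)).
Qed.

(** The annihilator of the left module [A w] is two-sided; as [w] is homogeneous, testing against
    homogeneous multiples of [w] separates the components of an annihilating element. *)
Lemma annv_graded_ideal (w : A) (x : G) : w \in L x ->
  is_graded_ideal L (annv fullv (vbasis (fullv * <[w]>)%VS)).
Proof.
move=> wx; set I := annv _ _.
have I_P a : reflect (forall b, a * (b * w) = 0) (a \in I).
  apply: (iffP (annv_vbasisP _ _ _)) => [[_ aw] b|aw].
    by apply: aw; rewrite memv_mul ?memvf ?memv_line.
  rewrite memvf; split=> // _ /memv_cosetP[b _ ->]; exact: aw.
have [[_ _ L_direct] _] := L_grading; split; split.
- by apply/prodvP => a b _ /I_P bI; apply/I_P => c; rewrite -mulrA bI mulr0.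
- by apply/prodvP => a b /I_P aI _; apply/I_P => c; rewrite -mulrA [b * _]mulrA aI.
- by move=> g; apply: capvSl.
- move=> a /I_P aI; have [r [u [ur _ uL aE]]] := homogeneous_decomposition a x.
  exists r => //; rewrite aE [X in X \in _]big_seq; apply: rpred_sum => h hr.
  suff: u h \in (I :&: L h)%VS.
    by apply: subvP; rewrite (big_rem h hr) addvSl.
  rewrite memv_cap uL andbT; apply/I_P => b.
  have [q [v [uq _ vL bE]]] := homogeneous_decomposition b x.
  rewrite bE mulr_suml mulr_sumr big1 // => k _.
  apply: (@grading_shift_independent r (k * x)%g (fun h => u h * (v k * w))) => //.
    by move=> i; rewrite !grading_mul.
  by rewrite -mulr_suml -aE aI.
- by move=> r /L_direct; apply: directv_sumS => h; apply: capvSr.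
Qed.

(* The graded module [A w] generated by the resulting [w] is graded-simple. *)
Lemma minimal_homogeneous : exists x w, [/\ w \in L x, w != 0 &
  forall z u, u \in L z -> u != 0 -> u \in (fullv * <[w]>)%VS ->
    (fullv * <[u]> = fullv * <[w]>)%VS].
Proof.
have [x [w [wx w0]]] : exists x w, w \in L x /\ w != 0.
  have [r [u [_ _ uL one]]] := homogeneous_decomposition 1 1%g.
  have /hasP[h _ uh] : has (fun h => u h != 0) r.
    apply: contraT => /hasPn u0; move: (oner_neq0 A).
    by rewrite one big_seq big1 ?eqxx // => h /u0/negPn/eqP.
  by exists h, (u h).
have [n] := ubnP (\dim (fullv * <[w]>)).
elim: n => // n IHn in x w wx w0 * => le_n.
(* Descent: a [u] generating a strictly smaller module replaces [w]; otherwise [A u], contained in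
   [A w], has full dimension. *)
have [[z [u [uz u0 uw lt_uw]]]|no_u] := EM (exists z u, [/\ u \in L z, u != 0,
    u \in (fullv * <[w]>)%VS & (\dim (fullv * <[u]>) < \dim (fullv * <[w]>))%N]).
  exact: (IHn z u uz u0 (leq_trans lt_uw le_n)).
exists x, w; split=> // z u uz u0 uw; apply/eqP; rewrite eqEdim; apply/andP; split.
  apply/prodvP => a _ _ /vlineP[k ->]; case/memv_cosetP: uw => b _ ->.
  by rewrite -scalerAr mulrA rpredZ ?memv_mul ?memvf ?memv_line.
by rewrite leqNgt; apply/negP => lt_uw; case: no_u; exists z, u.
Qed.

End Grading.

(** * Application to the module generated by a minimal homogeneous element *)

Lemma graded_simple_dim_le (K : closedFieldType) (A : falgType K) (G : groupType)
    (L : G -> {vspace A}) (g : G) : is_grading L -> graded_simple L ->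
  (\dim (L g) <= \dim (L 1%g))%N.
Proof.
move=> grL simL; have [y [w [wy w0 w_min]]] := minimal_homogeneous grL.
have [S SP] := grading_support grL.
(* Components are indexed by the degree of the coefficient, so [M x] sits in degree [x * y] of
   [A]. *)
pose M x := (L x * <[w]>)%VS.
have MP x u : reflect (exists2 a, a \in L x & u = a * w) (u \in M x).
  exact: memv_cosetP.
have ML x : (M x <= L (x * y)%g)%VS.
  by apply/subvP => _ /MP[a ax ->]; apply: (grading_mul grL).
have w_coset a : a * w \in (fullv * <[w]>)%VS.
  by rewrite memv_mul ?memvf ?memv_line.
apply: (@dim_homogeneous_le _ _ _ L M _ _ _ _ _ [seq (h / y)%g | h <- S]).
- exact: grading_mul.
- by move=> h x a _ ah /MP[b bx ->]; apply/MP; exists (a * b); rewrite ?mulrA ?(grading_mul grL).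
(* Minimality gives [A u = A w], so [u'] is a multiple of [u]; its coefficient can be taken
   homogeneous. *)
- move=> x z u u' uM u0 u'M.
  have u'u : u' \in (fullv * <[u]>)%VS.
    rewrite (w_min _ _ (subvP (ML x) _ uM) u0); last by case/MP: uM => a _ ->.
    by case/MP: u'M => a _ ->.
  case/memv_cosetP: u'u => a _ E; rewrite E in u'M *.
  have [b bzx ->] := homogeneous_factor grL (subvP (ML x) _ uM) (subvP (ML z) _ u'M).
  by exists b => //; rewrite invgM mulgA mulgK in bzx.
- move=> T uT; apply: directv_sumS ML _.
  have [[_ _ L_direct] _] := grL; have := L_direct [seq (h * y)%g | h <- T].
  rewrite (map_inj_uniq (@mulIg _ y)) => /(_ uT).
  by rewrite !directvE /= !big_map.
(* The annihilator of [A w] is [0], which is faithfulness, or everything, which would give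
   [1 * w = 0]. *)
- move=> h f fh fM; case: (simL _ (annv_graded_ideal grL wy)) => I_E.
    apply/eqP; rewrite -memv0 -I_E; apply/annv_vbasisP.
    rewrite memvf; split=> // _ /memv_cosetP[b _ ->].
    have [r [u [_ _ uL ->]]] := homogeneous_decomposition grL b 1%g.
    rewrite mulr_suml mulr_sumr big1 // => k _; apply: (fM k).
    by apply/MP; exists (u k).
  have : 1 \in @fullv _ A by apply: memvf.
  rewrite -I_E => /annv_vbasisP[_ /(_ _ (w_coset 1))].
  by rewrite !mul1r => /eqP; rewrite (negPf w0).
move=> x Mx; apply/mapP; exists (x * y)%g; last by rewrite mulgK.
by apply: SP; apply: contraNneq Mx => Lxy; rewrite -subv0 -Lxy.
Qed.

Theorem theoremB (R : realType) (A : falgType R[i]) (G : groupType)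
    (L : G -> {vspace A}) (hgrading : is_grading L) (hsimple : graded_simple L)
    (g : G) : (\dim (L g) <= \dim (L 1%g))%N.
Proof. exact: graded_simple_dim_le. Qed.
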